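(* Let $N\in\mathbb{N}$, and let $q=q(N)$ with $0<q(N)\le 1/2$ and $M=M(N)\in\mathbb{N}$ be functions possibly depending on $N$. Let $A$ be an $M\times N$ random matrix whose entries are independent Bernoulli$(q)$ random variables, and let $\mathcal{A}$ be the property that $A$ has pairwise different columns. Define $$\hat{M}(N)=\frac{\log(N)}{\log\left(1/\sqrt{q^2+(1-q)^2}\right)}.$$ Then $\hat M$ is a threshold function for $\mathcal{A}$: for any $0<q(N)\le 1/2$ and any function $\epsilon(N)$ with $\frac{1}{\log(N)}\ll\epsilon(N)\ll 1$, (i) if $M\ge(1+\epsilon(N))\hat{M}$, then $\lim_{N\to\infty}\mathbb{P}(A\in\mathcal{A})=1$; (ii) if $M\le(1-\epsilon(N))\hat{M}$, then $\lim_{N\to\infty}\mathbb{P}(A\in\mathcal{A})=0$.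
   Context: For functions $f,g$ of $N$, $f\ll g$ means $f(N)/g(N)\to 0$ as $N\to\infty$. $\log$ denotes the natural logarithm.
   Formalization: The function ε(N) is additionally assumed to be positive for all sufficiently large N; with the literal definition of ≪, a negative ε such as −1/√(log N) would be allowed and (i) would fail. *)

(* Defs.v *)
From HB Require Import structures.
From mathcomp Require Import all_boot all_order all_algebra.
From mathcomp Require Import all_classical all_reals all_analysis.

Set Implicit Arguments.
Unset Strict Implicit.
Unset Printing Implicit Defensive.

Import Order.TTheory GRing.Theory Num.Theory.
Import numFieldNormedType.Exports.

Local Open Scope classical_set_scope.
Local Open Scope ring_scope.

(* Division is total with x / 0 = 0, so this is meaningful only when g is
   eventually nonzero. *)
Definition asymp_lt (R : realType) (f g : nat -> R) : Prop :=
  f N / g N @[N --> \oo] --> (0 : R).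

Definition mutually_independent (d d' : measure_display)
    (T : measurableType d) (T' : measurableType d') (R : realType)
    (P : probability T R) (I : finType) (X : I -> {RV P >-> T'}) : Prop :=
  forall (J : {set I}) (B : I -> set T'), (forall i, measurable (B i)) ->
    P (\bigcap_(i in [set` J]) (X i @^-1` B i)) =
    (\prod_(i in J) P (X i @^-1` B i))%E.

(* [bernoulli_prob] lives on [bool]; the entries 1 and 0 are true and false. *)
Definition bernoulli_matrix (d : measure_display) (T : measurableType d)
    (R : realType) (P : probability T R) (m n : nat) (q : R)
    (A : 'I_m -> 'I_n -> {RV P >-> bool}) : Prop :=
  (forall i j (B : set bool), distribution P (A i j) B = bernoulli_prob q B) /\
  mutually_independent (fun ij : 'I_m * 'I_n => A ij.1 ij.2).

Definition different_columns (m n : nat) (B : 'M[bool]_(m, n)) : Prop :=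
  forall j k : 'I_n, j != k -> col j B != col k B.

Definition different_columns_event (d : measure_display)
    (T : measurableType d) (R : realType) (P : probability T R) (m n : nat)
    (A : 'I_m -> 'I_n -> {RV P >-> bool}) : set T :=
  [set w | different_columns (\matrix_(i, j) A i j w)].

Definition Mhat (R : realType) (q : nat -> R) (N : nat) : R :=
  ln N%:R / ln (1 / Num.sqrt (q N ^+ 2 + (1 - q N) ^+ 2)).

(* Main.v *)
Require Import Defs.
From HB Require Import structures.
From mathcomp Require Import all_boot all_order all_algebra.
From mathcomp Require Import all_classical all_reals all_analysis.
From mathcomp Require Import ring lra zify.

Set Implicit Arguments.
Unset Strict Implicit.
Unset Printing Implicit Defensive.

Import Order.TTheory GRing.Theory Num.Theory.
Import numFieldNormedType.Exports.

Local Open Scope ring_scope.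

(** The columns are i.i.d. words in [{0,1}^M], so this is a birthday problem.
    Writing [s = sqrt (q^2 + (1-q)^2)], two given columns coincide with
    probability [s^(2M)], and three with probability at most [s^(3M)] because
    the l^3 norm is at most the l^2 norm. Hence with [z = N s^M] a union bound
    gives [1 - P <= z^2], while Chebyshev's inequality, applied to the number of
    coincidences between a first and a second half of the columns, gives
    [P = O(1/z + 1/z^2)]. The hypotheses on [M] say that [z <= exp(- eps ln N)],
    respectively [z >= exp(eps ln N)], and [eps ln N] tends to infinity. *)

(** * Words with i.i.d. letters: agreement probabilities and the union bound *)

Section IidWord.
Variables (R : realFieldType) (I C : finType) (mu : C -> R).
Hypothesis mu_ge0 : forall c, 0 <= mu c.
Hypothesis mu_sum1 : \sum_c mu c = 1.

Definition word_weight (f : {ffun I -> C}) : R := \prod_i mu (f i).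
(** The probability that [r] independent letters of law [mu] all agree. *)
Definition power_sum (r : nat) : R := \sum_c mu c ^+ r.

Lemma word_weight_ge0 f : 0 <= word_weight f.
Proof. by apply: prodr_ge0. Qed.

Lemma sum_word_weight : \sum_f word_weight f = 1.
Proof. by rewrite /word_weight -(bigA_distr_bigA (fun _ => mu)) big1. Qed.

Lemma prob_injective_le1 :
  \sum_(f : {ffun I -> C} | injectiveb f) word_weight f <= 1.
Proof.
rewrite -sum_word_weight.
rewrite [leRHS](bigID (fun f : {ffun I -> C} => injectiveb f)) /= lerDl.
by apply: sumr_ge0 => *; exact: word_weight_ge0.
Qed.

(** The constraint acts on each position separately, so distributivity turns the sum into a product
    over positions; a position outside [J] contributes the total mass 1. *)
Lemma sum_word_weight_eq_on (J : {set I}) (c : I -> C) :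
  \sum_(f : {ffun I -> C} | [forall i in J, f i == c i]) word_weight f =
  \prod_(i in J) mu (c i).
Proof.
pose Q i := [pred x : C | (i \in J) ==> (x == c i)].
rewrite (eq_bigl (fun f => f \in family Q)); last first.
  by move=> f; apply/forallP/familyP => h i; exact: h.
rewrite /word_weight -(bigA_distr_big_dep Q (fun _ => mu)) /=.
rewrite [RHS]big_mkcond; apply: eq_bigr => i _.
rewrite /Q; case: (i \in J) => /=; last exact: mu_sum1.
by rewrite big_pred1_eq.
Qed.

Lemma sum_word_weight_const_on (J : {set I}) (c : C) :
  \sum_(f : {ffun I -> C} | [forall i in J, f i == c]) word_weight f =
  mu c ^+ #|J|.
Proof. by rewrite sum_word_weight_eq_on prodr_const. Qed.

(** Condition on the common letter, which is the value of [f] at [j]. *)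
Lemma sum_word_weight_eq_at (J : {set I}) (j : I) : j \in J ->
  \sum_(f : {ffun I -> C} | [forall i in J, f i == f j]) word_weight f =
  power_sum #|J|.
Proof.
move=> jJ; rewrite (partition_big (fun f : {ffun I -> C} => f j) predT) //=.
apply: eq_bigr => c _; rewrite -sum_word_weight_const_on; apply: eq_bigl => f.
apply/andP/idP => [[h /eqP <- //]|h].
have /eqP fj : f j == c by move: (forall_inP h j jJ).
by rewrite fj eqxx.
Qed.

Lemma sum_word_weight_eq2 (j k : I) : j != k ->
  \sum_(f : {ffun I -> C} | f j == f k) word_weight f = power_sum 2.
Proof.
move=> jk; have <- : #|[set j; k]| = 2%N by rewrite cards2 jk.
rewrite -(@sum_word_weight_eq_at _ j) ?set21//; apply: eq_bigl => f.
apply/idP/forall_inP => [h i /set2P[]->//|h]; first by rewrite eq_sym.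
by rewrite eq_sym h // set22.
Qed.

Lemma sum_word_weight_eq3 (j k l : I) : j != k -> j != l -> k != l ->
  \sum_(f : {ffun I -> C} | (f j == f k) && (f j == f l)) word_weight f =
  power_sum 3.
Proof.
move=> jk jl kl; have <- : #|[set j; k; l]| = 3%N.
  by rewrite -finset.setUA cardsU1 cards2 kl !inE negb_or jk jl.
rewrite -(@sum_word_weight_eq_at _ j) ?inE ?eqxx//; apply: eq_bigl => f.
apply/andP/forall_inP => [[/eqP h1 /eqP h2] i|h].
  by rewrite !inE -orbA => /or3P[] /eqP->; rewrite -?h1 -?h2.
by rewrite !(eq_sym (f j)) !h // !inE eqxx ?orbT.
Qed.

(** Two agreements on four distinct positions are independent: condition on both common letters and
    factor. *)
Lemma sum_word_weight_eq4 (j k j' k' : I) : uniq [:: j; k; j'; k'] ->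
  \sum_(f : {ffun I -> C} | (f j == f k) && (f j' == f k')) word_weight f =
  power_sum 2 ^+ 2.
Proof.
rewrite /= !inE !negb_or => /and4P[/and3P[jk jj' jk'] /andP[kj' kk'] j'k' _].
rewrite (partition_big (fun f : {ffun I -> C} => (f j, f j')) predT) //=.
rewrite expr2 /power_sum mulr_suml.
under [RHS]eq_bigr do rewrite mulr_sumr.
rewrite pair_big /=; apply: eq_bigr => -[c c'] _ /=.
(* Only the values at the four positions matter: [c] at [j] and [k], [c'] at [j'] and [k']. *)
pose col i := if (i == j) || (i == k) then c else c'.
have := sum_word_weight_eq_on (j |: (k |: [set j'; k'])) col.
have colE : (col j = c) * (col k = c) * (col j' = c') * (col k' = c').
  rewrite /col !eqxx orbT ![_ == j]eq_sym ![_ == k]eq_sym.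
  by rewrite (negbTE jj') (negbTE jk') (negbTE kj') (negbTE kk').
rewrite !big_setU1 ?big_set1 ?inE ?negb_or ?jk ?jj' ?jk' ?kj' ?kk' //=.
rewrite !colE !mulrA -expr2 -mulrA -expr2 => <-; apply: eq_bigl => f.
rewrite xpair_eqE; apply/andP/forall_inP => [[/andP[/eqP h1 /eqP h2]]|h].
  move=> /andP[/eqP h3 /eqP h4] i.
  by rewrite !inE => /or4P[] /eqP->; rewrite colE -?h1 -?h2 ?h3 ?h4.
have Hj i x : i \in [:: j; k; j'; k'] -> col i = x -> f i = x.
  by move=> hi <-; apply/eqP/h; move: hi; rewrite !inE.
rewrite (Hj j c) ?(Hj k c) ?(Hj j' c') ?(Hj k' c') ?colE ?eqxx //;
  by rewrite !inE eqxx ?orbT.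
Qed.

Lemma prob_injective_ge :
  1 - power_sum 2 * #|I|%:R ^+ 2 <=
  \sum_(f : {ffun I -> C} | injectiveb f) word_weight f.
Proof.
rewrite -[X in X - _]sum_word_weight lerBlDr.
rewrite [leLHS](bigID (fun f : {ffun I -> C} => injectiveb f)) /= lerD2l.
(* The bound charges [power_sum 2] to every ordered pair, the diagonal included, which costs only a
   constant factor. *)
have -> : power_sum 2 * #|I|%:R ^+ 2 = \sum_(jk : I * I) power_sum 2.
  by rewrite sumr_const card_prod -[RHS]mulr_natr natrM expr2.
have S2_ge0 : 0 <= power_sum 2 by apply: sumr_ge0 => c _; rewrite exprn_ge0.
apply: (@le_trans _ _ (\sum_(jk : I * I | jk.1 != jk.2)
   \sum_(f : {ffun I -> C} | f jk.1 == f jk.2) word_weight f)); last first.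
  rewrite [leRHS](bigID (fun jk : I * I => jk.1 != jk.2)) /=.
  rewrite (eq_bigr (fun=> power_sum 2)); last first.
    by move=> jk; exact: sum_word_weight_eq2.
  by rewrite lerDl sumr_ge0.
rewrite (exchange_big_dep predT) //= [leLHS]big_mkcond; apply: ler_sum => f _.
case: ifPn => [|_]; last by apply: sumr_ge0 => *; exact: word_weight_ge0.
(* A word that is not injective is counted at least once, at a pair witnessing the collision. *)
move=> /injectivePn[j [k jk fjk]].
rewrite (bigD1 (j, k)) /= ?jk ?fjk ?eqxx // lerDl.
by apply: sumr_ge0 => *; exact: word_weight_ge0.
Qed.

(** * Second moment of the coincidences between two disjoint sets of positions *)

Variables L K : {set I}.
Hypothesis disjLK : [disjoint L & K].

Local Notation ell := (#|L|%:R : R).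
Local Notation kay := (#|K|%:R : R).

(* Counting only the coincidences between [L] and [K] leaves few coincidence
   patterns of two pairs [(j, k)] and [(j', k')]. *)
Definition coincidences (f : {ffun I -> C}) : R :=
  \sum_(j in L) \sum_(k in K) (f j == f k)%:R.

Lemma neqLK j k : j \in L -> k \in K -> j != k.
Proof.
by move=> jL kK; apply: contraTneq kK => <-; rewrite (disjointFr disjLK jL).
Qed.

Lemma first_moment :
  \sum_f word_weight f * coincidences f = ell * kay * power_sum 2.
Proof.
under eq_bigr do rewrite mulr_sumr.
rewrite exchange_big /=.
rewrite (eq_bigr (fun=> kay * power_sum 2)); last first.
  move=> j jL; under eq_bigr do rewrite mulr_sumr.
  rewrite exchange_big /= (eq_bigr (fun=> power_sum 2)); last first.
    move=> k kK; rewrite -(sum_word_weight_eq2 (neqLK jL kK)) [RHS]big_mkcond.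
    by apply: eq_bigr => f _; case: eqP; rewrite ?mulr1 ?mulr0.
  by rewrite sumr_const -[LHS]mulr_natl.
by rewrite sumr_const -[LHS]mulr_natl mulrA.
Qed.

(** Disjointness of [L] and [K] allows overlaps only through [j = j'] or [k = k'], so four, three or
    two distinct positions remain. Writing the cases as one sum with indicators makes the bound easy
    to sum over all quadruples. *)
Lemma pair_prob_le j k j' k' : j \in L -> k \in K -> j' \in L -> k' \in K ->
  \sum_f word_weight f * ((f j == f k)%:R * (f j' == f k')%:R) <=
  power_sum 2 ^+ 2 + (j == j')%:R * power_sum 3 + (k == k')%:R * power_sum 3
   + (j == j')%:R * (k == k')%:R * power_sum 2.
Proof.
move=> jL kK j'L k'K.
have S_ge0 r : 0 <= power_sum r by apply: sumr_ge0 => c _; rewrite exprn_ge0.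
have -> : \sum_f word_weight f * ((f j == f k)%:R * (f j' == f k')%:R) =
    \sum_(f : {ffun I -> C} | (f j == f k) && (f j' == f k')) word_weight f.
  rewrite [RHS]big_mkcond; apply: eq_bigr => f _.
  by rewrite -natrM mulnb; case: andP; rewrite ?mulr1 ?mulr0.
have := S_ge0 2%N; have := S_ge0 3%N; have := sqr_ge0 (power_sum 2).
have [<-|jj'] := eqVneq j j'; have [<-|kk'] := eqVneq k k' => /= S22 S3 S2;
  rewrite ?(mul1r, mul0r) ?addr0.
- under eq_bigl do rewrite andbb.
  by rewrite (sum_word_weight_eq2 (neqLK jL kK)) lerDr !addr_ge0.
- by rewrite (sum_word_weight_eq3 (neqLK jL kK) (neqLK jL k'K) kk') lerDr.
- rewrite (eq_bigl (fun f : {ffun I -> C} => (f k == f j) && (f k == f j'))).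
    by rewrite sum_word_weight_eq3 ?lerDr // eq_sym neqLK.
  by move=> f; rewrite !(eq_sym (f k)).
- rewrite sum_word_weight_eq4 //= !inE !negb_or jj' kk' (neqLK jL kK).
  by rewrite (neqLK jL k'K) (neqLK j'L k'K) eq_sym (neqLK j'L kK).
Qed.

(** Expand the square into quadruples and sum [pair_prob_le]: each indicator removes one free index.
    The leading term is the squared mean, which cancels in the variance. *)
Lemma second_moment_le : \sum_f word_weight f * coincidences f ^+ 2 <=
  (ell * kay * power_sum 2) ^+ 2
   + (ell * kay ^+ 2 + ell ^+ 2 * kay) * power_sum 3 + ell * kay * power_sum 2.
Proof.
have sum_cst (A : {set I}) (x : R) : \sum_(i in A) x = #|A|%:R * x.
  by rewrite sumr_const -[LHS]mulr_natl.
have ind (A : {set I}) i : i \in A -> \sum_(i' in A) (i == i')%:R = 1 :> R.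
  move=> iA; rewrite (bigD1 i) //= eqxx big1 ?addr0 // => i' /andP[_].
  by rewrite eq_sym => /negbTE->.
have -> : \sum_f word_weight f * coincidences f ^+ 2 =
    \sum_(j in L) \sum_(k in K) \sum_(j' in L) \sum_(k' in K)
      \sum_f word_weight f * ((f j == f k)%:R * (f j' == f k')%:R).
  (* The sum over [f] moves outwards past the four index sums, one at a time. *)
  under [RHS]eq_bigr do under eq_bigr do under eq_bigr do
    rewrite exchange_big /=.
  under [RHS]eq_bigr do under eq_bigr do rewrite exchange_big /=.
  under [RHS]eq_bigr do rewrite exchange_big /=.
  rewrite [RHS]exchange_big /=; apply: eq_bigr => f _.
  rewrite expr2 {1}/coincidences mulr_suml mulr_sumr; apply: eq_bigr => j _.
  rewrite mulr_suml mulr_sumr; apply: eq_bigr => k _.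
  rewrite /coincidences !mulr_sumr; apply: eq_bigr => j' _.
  by rewrite !mulr_sumr; apply: eq_bigr.
apply: (@le_trans _ _ (\sum_(j in L) \sum_(k in K) \sum_(j' in L)
  \sum_(k' in K) (power_sum 2 ^+ 2 + (j == j')%:R * power_sum 3
   + (k == k')%:R * power_sum 3 + (j == j')%:R * (k == k')%:R * power_sum 2))).
  do 4![apply: ler_sum => ? ?]; exact: pair_prob_le.
rewrite le_eqVlt; apply/orP; left; apply/eqP.
transitivity (\sum_(j in L) \sum_(k in K)
  (ell * (kay * power_sum 2 ^+ 2 + power_sum 3) + kay * power_sum 3
   + power_sum 2)).
  apply: eq_bigr => j jL; apply: eq_bigr => k kK.
  transitivity (\sum_(j' in L) (kay * power_sum 2 ^+ 2 + power_sum 3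
      + (j == j')%:R * (kay * power_sum 3 + power_sum 2))).
    apply: eq_bigr => j' _; rewrite !big_split /= !sum_cst -mulr_suml ind //.
    rewrite -mulr_suml -mulr_sumr ind //; ring.
  rewrite !big_split /= !sum_cst -mulr_suml ind //; ring.
rewrite !sum_cst; ring.
Qed.

(** Chebyshev: an injective word has no coincidence, hence deviates from the mean [m] by exactly
    [m]. The probability is thus at most the variance divided by [m ^+ 2]. *)
Lemma prob_injective_le : 0 < ell * kay * power_sum 2 ->
  \sum_(f : {ffun I -> C} | injectiveb f) word_weight f <=
  (ell + kay) / (ell * kay) * (power_sum 3 / power_sum 2 ^+ 2)
   + (ell * kay * power_sum 2)^-1.
Proof.
move=> m_gt0; set m := ell * kay * power_sum 2 in m_gt0 *.
have cheb : m ^+ 2 * \sum_(f : {ffun I -> C} | injectiveb f) word_weight f <=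
    \sum_f word_weight f * (coincidences f - m) ^+ 2.
  rewrite mulr_sumr [leLHS]big_mkcond; apply: ler_sum => f _.
  case: ifPn => [/injectiveP injf|_]; last first.
    by rewrite mulr_ge0 ?sqr_ge0 ?word_weight_ge0.
  rewrite /coincidences big1 ?sub0r ?sqrrN 1?mulrC // => j jL.
  apply: big1 => k kK.
  by rewrite (inj_eq injf) (negbTE (neqLK jL kK)).
have var : \sum_f word_weight f * (coincidences f - m) ^+ 2 =
    \sum_f word_weight f * coincidences f ^+ 2 - m ^+ 2.
  transitivity (\sum_f (word_weight f * coincidences f ^+ 2
      - 2 * m * (word_weight f * coincidences f) + m ^+ 2 * word_weight f)).
    by apply: eq_bigr => f _; ring.
  rewrite big_split /= sumrB -!mulr_sumr first_moment sum_word_weight -/m; ring.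
have := second_moment_le; rewrite -/m => sm.
have {}sm : m ^+ 2 * \sum_(f : {ffun I -> C} | injectiveb f) word_weight f <=
   (ell * kay ^+ 2 + ell ^+ 2 * kay) * power_sum 3 + m.
  by apply: (le_trans cheb); rewrite var; lra.
have m2 : 0 < m ^+ 2 by rewrite exprn_gt0.
rewrite mulrC -ler_pdivlMr // in sm; apply: (le_trans sm).
rewrite le_eqVlt; apply/orP; left; apply/eqP; rewrite /m.
have : m != 0 by rewrite gt_eqF.
rewrite /m !mulf_eq0 !negb_or => /andP[/andP[l0 k0] s0].
by field; rewrite l0 k0 s0.
Qed.
End IidWord.

(** * From the random matrix to weighted words of columns *)

Local Open Scope classical_set_scope.

Lemma measure_preimage_finType (d : measure_display) (T : measurableType d)
    (R : realType) (mu : {measure set T -> \bar R}) (K : finType) (F : T -> K)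
    (Q : pred K) : (forall k, measurable (F @^-1` [set k])) ->
  mu [set w | Q (F w)] = (\sum_(k | Q k) mu (F @^-1` [set k]))%E.
Proof.
move=> mF; rewrite -big_filter.
have -> : [set w | Q (F w)] = [set w | F w \in [seq k <- index_enum K | Q k]].
  by apply/seteqP; split => w /=; rewrite mem_filter mem_index_enum andbT.
have := filter_uniq Q (index_enum_uniq K).
elim: [seq _ <- _ | _] => [|k s ih] /=.
  by move=> _; rewrite big_nil -[RHS](measure0 mu); congr (mu _);
    apply/seteqP; split.
move=> /andP[ks us]; rewrite big_cons -ih //.
have E : [set w | F w \in s] = \big[setU/set0]_(k <- s) F @^-1` [set k].
  rewrite -bigcup_seq; apply/seteqP; split => [w Fw|w [i /= si Fi]].
    by exists (F w).
  by rewrite Fi.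
rewrite -measureU //.
- congr (mu _); apply/seteqP; split => w /=; rewrite inE.
    by case/predU1P; [left|right].
  by case=> ->; rewrite ?eqxx ?orbT.
- by rewrite E; apply: bigsetU_measurable => i _; exact: mF.
- by apply/seteqP; split => // w [] /= ->; rewrite (negbTE ks).
Qed.

Section BernoulliMatrix.
Variables (R : realType) (q : R).
Hypothesis q01 : 0 <= q <= 1.

Lemma bernoulli_prob_set1 b : bernoulli_prob q [set b] = (bernoulli_pmf q b)%:E.
Proof. by rewrite /bernoulli_prob q01 fsbig_set1. Qed.

Definition column_pmf m (c : {ffun 'I_m -> bool}) : R :=
  \prod_i bernoulli_pmf q (c i).

Lemma column_pmf_ge0 m (c : {ffun 'I_m -> bool}) : 0 <= column_pmf c.
Proof. by apply: prodr_ge0 => i _; exact: bernoulli_pmf_ge0. Qed.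

(** A power of a product weight is again a product weight, so the sum factors over the rows. *)
Lemma sum_column_pmfX m r :
  \sum_(c : {ffun 'I_m -> bool}) column_pmf c ^+ r =
  (q ^+ r + (1 - q) ^+ r) ^+ m.
Proof.
under eq_bigr do rewrite -prodrXl.
rewrite -(bigA_distr_bigA (fun _ b => bernoulli_pmf q b ^+ r)).
by rewrite prodr_const card_ord big_bool.
Qed.

Lemma sum_column_pmf m : \sum_(c : {ffun 'I_m -> bool}) column_pmf c = 1.
Proof.
under eq_bigr do rewrite -[column_pmf _]expr1.
by rewrite sum_column_pmfX !expr1 addrC subrK expr1n.
Qed.

(** The event depends only on the finite-valued word of columns [F], and is injectivity of that
    word. Independence of all entries gives [F] its product point masses. *)
Lemma prob_different_columns (d : measure_display) (T : measurableType d)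
    (P : probability T R) m n (A : 'I_m -> 'I_n -> {RV P >-> bool}) :
  bernoulli_matrix q A ->
  P (different_columns_event A) =
  (\sum_(f : {ffun 'I_n -> {ffun 'I_m -> bool}} | injectiveb f)
     \prod_j column_pmf (f j))%:E.
Proof.
move=> [bA iA].
pose F w : {ffun 'I_n -> {ffun 'I_m -> bool}} :=
  [ffun j => [ffun i => A i j w]].
have FE f : F @^-1` [set f] = \bigcap_(ij in [set` [set: 'I_m * 'I_n]%SET])
    (A ij.1 ij.2 @^-1` [set f ij.2 ij.1]).
  apply/seteqP; split => [w /= <- [i j] _ /=|w Fw]; first by rewrite !ffunE.
  apply/ffunP => j; apply/ffunP => i; rewrite !ffunE.
  by apply: (Fw (i, j)); rewrite /= inE.
have mA i j b : measurable (A i j @^-1` [set b]).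
  by rewrite -[_ @^-1` _]setTI; exact: measurable_funP.
have -> : different_columns_event A = [set w | injectiveb (F w)].
  apply/seteqP; split => w /=.
    move=> dA; apply/injectiveP => j k Fjk; apply/eqP/negPn/negP => /dA/eqP.
    apply; apply/colP => i; rewrite !mxE.
    by have := congr1 (fun g : {ffun _ -> _} => g i) Fjk; rewrite !ffunE.
  move=> /injectiveP injF j k; apply: contra_neq => /colP cjk; apply: injF.
  by apply/ffunP => i; have := cjk i; rewrite !mxE !ffunE.
rewrite (measure_preimage_finType P (F := F)
  (fun f : {ffun 'I_n -> {ffun 'I_m -> bool}} => injectiveb f)); last first.
  move=> f; rewrite FE; apply: fin_bigcap_measurable => // ij _; exact: mA.
rewrite -sumEFin; apply: eq_bigr => f _; rewrite FE.
apply: (eq_trans (iA [set: 'I_m * 'I_n]%SET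
  (fun ij => [set f ij.2 ij.1]) (fun=> Logic.I))).
transitivity (\prod_(ij in [set: 'I_m * 'I_n]%SET)
   (bernoulli_pmf q (f ij.2 ij.1))%:E)%E.
  apply: eq_bigr => -[i j] _ /=.
  have := bA i j [set f j i].
  by rewrite /distribution /pushforward bernoulli_prob_set1.
rewrite prodEFin (eq_bigl predT); last by move=> ij; rewrite !inE.
by rewrite -(pair_bigA _ (fun i j => bernoulli_pmf q (f j i))) /= exchange_big.
Qed.
End BernoulliMatrix.

(** * Explicit bounds for a fixed matrix size *)

Section FixedSize.
Variables (R : realType) (q : R) (d : measure_display) (T : measurableType d).
Variables (P : probability T R) (m n : nat).
Variable A : 'I_m -> 'I_n -> {RV P >-> bool}.
Hypothesis q_itv : 0 < q <= 1 / 2.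
Hypothesis bA : bernoulli_matrix q A.

Local Notation s := (Num.sqrt (q ^+ 2 + (1 - q) ^+ 2)).

Let q01 : 0 <= q <= 1.
Proof. by have /andP[q_gt0 q_le] := q_itv; apply/andP; split; lra. Qed.

Let s2E : s ^+ 2 = q ^+ 2 + (1 - q) ^+ 2.
Proof. by rewrite sqr_sqrtr // addr_ge0 ?sqr_ge0. Qed.

Let s_gt0 : 0 < s.
Proof. by have /andP[q_gt0 q_le] := q_itv; rewrite sqrtr_gt0; nra. Qed.

(** Here [s ^+ 2 = 1 - 2 * q * (1 - q)]. Strictness makes the denominator of [Mhat] positive. *)
Let s_lt1 : s < 1.
Proof.
have /andP[q_gt0 q_le] := q_itv.
by rewrite -(@ltr_pXn2r _ 2) ?nnegrE ?ltW // expr1n s2E; nra.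
Qed.

Let power_sum2 : power_sum (@column_pmf R q m) 2 = (s ^+ m) ^+ 2.
Proof. by rewrite /power_sum sum_column_pmfX -exprM mulnC exprM s2E. Qed.

Let power_sum3_le : power_sum (@column_pmf R q m) 3 <= (s ^+ m) ^+ 3.
Proof.
have /andP[q_gt0 q_le] := q_itv.
have t_ge0 : 0 <= q ^+ 3 + (1 - q) ^+ 3 by rewrite addr_ge0 ?exprn_ge0 //; lra.
have s3_ge0 : 0 <= s ^+ 3 by rewrite exprn_ge0 // ltW.
rewrite /power_sum sum_column_pmfX -exprM mulnC exprM lerXn2r ?nnegrE //.
(* The claim is reduced to one row; squaring both sides then removes the square root in [s ^+ 3]. *)
rewrite -(@ler_pXn2r _ 2) ?nnegrE // -exprM mulnC exprM s2E -subr_ge0.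
have -> : (q ^+ 2 + (1 - q) ^+ 2) ^+ 3 - (q ^+ 3 + (1 - q) ^+ 3) ^+ 2 =
    (q * (1 - q)) ^+ 2 * (2 * q ^+ 2 + 2 * (1 - q) ^+ 2 + (q - (1 - q)) ^+ 2).
  by ring.
apply: mulr_ge0; first exact: sqr_ge0.
apply: addr_ge0; last exact: sqr_ge0.
by apply: addr_ge0; apply: mulr_ge0; rewrite ?sqr_ge0.
Qed.

Lemma prob_different_columns_ge :
  1 - (n%:R * s ^+ m) ^+ 2 <= fine (P (different_columns_event A)).
Proof.
rewrite (prob_different_columns q01 bA) /=.
have := prob_injective_ge 'I_n (@column_pmf_ge0 R q q01 m)
  (@sum_column_pmf R q m).
by rewrite power_sum2 card_ord exprMn mulrC.
Qed.

Lemma prob_different_columns_le : (1 < n)%N ->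
  fine (P (different_columns_event A)) <=
  8 * (n%:R * s ^+ m)^-1 + 16 * (n%:R * s ^+ m) ^- 2.
Proof.
move=> n1; rewrite (prob_different_columns q01 bA) /=.
(* [L] is the first block of [h] columns and [K] the next; an odd last column is ignored. As
   [1 < n], [h] is positive and [n <= 4 * h]. *)
pose h := n./2.
have h2 : (h + h <= n)%N by rewrite /h; lia.
have card_lt k : (k <= n)%N -> #|[set i : 'I_n | (i < k)%N]%SET| = k.
  move=> kn; rewrite cardsE -sum1_card -(big_ord_widen n (fun=> 1%N) kn).
  by rewrite sum1_card card_ord.
pose L := [set i : 'I_n | (i < h)%N]%SET.
pose K := ([set i : 'I_n | (i < h + h)%N] :\: L)%SET.
have cardL : #|L| = h by rewrite card_lt //; lia.
have cardK : #|K| = h.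
  rewrite cardsDS; first by rewrite cardL card_lt // addnK.
  by apply/fintype.subsetP => i; rewrite !inE => /ltn_addr.
have dLK : [disjoint L & K]%B.
  by apply/pred0P => i /=; rewrite !inE; lia.
have sm0 : 0 < s ^+ m by rewrite exprn_gt0.
have h0 : 0 < h%:R :> R by rewrite ltr0n /h; lia.
have n0 : 0 < n%:R :> R by rewrite ltr0n; lia.
have nh : n%:R <= 4 * h%:R :> R by rewrite -natrM ler_nat /h; lia.
have := prob_injective_le (@column_pmf_ge0 R q q01 m)
  (@sum_column_pmf R q m) dLK.
rewrite cardL cardK power_sum2.
have u0 : 0 < h%:R * s ^+ m by rewrite mulr_gt0.
have v0 : 0 < n%:R * s ^+ m by rewrite mulr_gt0.
have uv : (h%:R * s ^+ m)^-1 <= 4 * (n%:R * s ^+ m)^-1.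
  rewrite -[leLHS]mul1r ler_pdivrMr // mulrAC ler_pdivlMr // mul1r mulrA.
  by rewrite ler_pM2r.
move=> /(_ _)/le_trans; apply; first by rewrite !mulr_gt0.
(* With [#|L| = #|K| = h] and [power_sum3_le], the Chebyshev bound becomes [2 * u + u ^+ 2] for
   [u = (h%:R * s ^+ m)^-1]. Then [u <= 4 * v] yields the constants 8 and 16. *)
apply: (@le_trans _ _ (2 * (h%:R * s ^+ m)^-1 + ((h%:R * s ^+ m)^-1) ^+ 2)).
  apply: lerD; last first.
    by rewrite le_eqVlt; apply/orP; left; apply/eqP; field; rewrite !gt_eqF.
  have -> : 2 * (h%:R * s ^+ m)^-1 =
     (h%:R + h%:R) / (h%:R * h%:R) * ((s ^+ m) ^+ 3 / ((s ^+ m) ^+ 2) ^+ 2).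
    by field; rewrite !gt_eqF.
  rewrite ler_wpM2l // ?divr_ge0 ?mulr_ge0 ?addr_ge0 ?ler0n //.
  by rewrite ler_wpM2r // invr_ge0 exprn_ge0 // exprn_ge0 // ltW.
rewrite -exprVn; set v := (n%:R * _)^-1 in uv *; set u := (h%:R * _)^-1 in uv *.
have u_ge0 : 0 <= u by rewrite invr_ge0 ltW.
by nra.
Qed.

Let lnVs_gt0 : 0 < ln (1 / s).
Proof. by rewrite ln_gt0 // div1r invf_gt1. Qed.

Let sXE : s ^+ m = expR (- (m%:R * ln (1 / s))).
Proof.
by rewrite div1r lnV ?posrE // mulrN opprK expRM_natl lnK ?posrE.
Qed.

Lemma mulr_sqrtX_ge (e : R) : (0 < n)%N ->
  m%:R <= (1 - e) * (ln n%:R / ln (1 / s)) ->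
  expR (e * ln n%:R) <= n%:R * s ^+ m.
Proof.
move=> n0; rewrite mulrA ler_pdivlMr // => h.
rewrite sXE -{2}(lnK (x := n%:R)) ?posrE ?ltr0n // -expRD ler_expR; lra.
Qed.

Lemma mulr_sqrtX_le (e : R) : (0 < n)%N ->
  (1 + e) * (ln n%:R / ln (1 / s)) <= m%:R ->
  n%:R * s ^+ m <= expR (- (e * ln n%:R)).
Proof.
move=> n0; rewrite mulrA ler_pdivrMr // => h.
rewrite sXE -{1}(lnK (x := n%:R)) ?posrE ?ltr0n // -expRD ler_expR; lra.
Qed.
End FixedSize.

(** * Passage to the limit *)

Lemma expRN_le_inv (R : realType) (x : R) : 0 < x -> expR (- x) <= x^-1.
Proof.
move=> x0; rewrite expRN lef_pV2 ?posrE ?expR_gt0 //.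
by apply: le_trans (expR_ge1Dx x); rewrite lerDr.
Qed.


Theorem theorem2 (R : realType) (q : nat -> R) (M : nat -> nat)
    (hq : forall N, 0 < q N <= 1 / 2)
    (d : nat -> measure_display) (T : forall N, measurableType (d N))
    (P : forall N, probability (T N) R)
    (A : forall N, 'I_(M N) -> 'I_N -> {RV (P N) >-> bool})
    (hA : forall N, bernoulli_matrix (q N) (A N))
    (eps : nat -> R)
    (eps_gt0 : \forall N \near \oo, 0 < eps N)
    (eps_lower : asymp_lt (fun N => 1 / ln N%:R) eps)
    (eps_upper : asymp_lt eps (fun=> 1)) :
  ((\forall N \near \oo, (1 + eps N) * Mhat q N <= (M N)%:R) ->
     P N (different_columns_event (A N)) @[N --> \oo] --> 1%:E) /\
  ((\forall N \near \oo, (M N)%:R <= (1 - eps N) * Mhat q N) ->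
     P N (different_columns_event (A N)) @[N --> \oo] --> 0%:E).
Proof.
(* This is literally the quotient in [eps_lower], so it tends to 0. It dominates
   [expR (- (eps N * ln N%:R))], which turns both bounds into polynomials in [v N]. *)
pose v N : R := 1 / ln N%:R / eps N.
have v_cvg : v N @[N --> \oo] --> (0 : R) by [].
have v_gt0 : \forall N \near \oo,
    [/\ (1 < N)%N, 0 < v N & v N = (eps N * ln N%:R)^-1].
  near=> N.
  (* Sizes 0 and 1 are excluded so that [ln N%:R] is positive. *)
  have N1 : (1 < N)%N by near: N; exists 2%N.
  have e0 : 0 < eps N by near: N.
  have l0 : 0 < ln N%:R :> R by rewrite ln_gt0 // ltr1n.
  split => //; first by rewrite /v !divr_gt0.
  by rewrite /v div1r -invfM mulrC.
have q01 N : 0 <= q N <= 1.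
  by have /andP[q_gt0 q_le] := hq N; apply/andP; split; lra.
have prob_fin N : P N (different_columns_event (A N)) \is a fin_num.
  by rewrite (prob_different_columns (q01 N) (hA N)).
have prob01 N : 0 <= fine (P N (different_columns_event (A N))) <= 1.
  rewrite fine_ge0 //= (prob_different_columns (q01 N) (hA N)) /=.
  exact: (prob_injective_le1 'I_N (@column_pmf_ge0 _ _ (q01 N) (M N))
    (sum_column_pmf _ _)).
split=> hM; (apply: cvg_EFin; first exact: nearW).
- apply: (@squeeze_cvgr _ _ _ _ (fun N => 1 - v N ^+ 2) (fun=> 1)).
  + near=> N.
    have [N1 vN vE] : [/\ (1 < N)%N, 0 < v N & v N = (eps N * ln N%:R)^-1].
      by near: N.
    have /andP[_ ->] := prob01 N; rewrite andbT.
    apply: le_trans (prob_different_columns_ge (hq N) (hA N)).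
    set z := _ * _ ^+ _; have z_ge0 : 0 <= z by rewrite mulr_ge0.
    have v_ge0 : 0 <= v N by exact: ltW.
    rewrite lerD2l lerN2 lerXn2r ?nnegrE //.
    rewrite vE; apply: le_trans (expRN_le_inv _); last by rewrite -invr_gt0 -vE.
    apply: mulr_sqrtX_le => //; first exact: ltnW.
    by near: N.
  + rewrite -[X in _ --> X]subr0 -[X in _ - X](mulr0 0).
    by apply: cvgB; [exact: cvg_cst|exact: cvgM].
  + exact: cvg_cst.
- apply: (@squeeze_cvgr _ _ _ _ (fun=> 0) (fun N => 8 * v N + 16 * v N ^+ 2)).
  + near=> N.
    have [N1 vN vE] : [/\ (1 < N)%N, 0 < v N & v N = (eps N * ln N%:R)^-1].
      by near: N.
    have /andP[-> _] := prob01 N; rewrite andTb.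
    apply: (le_trans (prob_different_columns_le (hq N) (hA N) N1)).
    have x0 : 0 < eps N * ln N%:R by rewrite -invr_gt0 -vE.
    set z := _ * _ ^+ _.
    have zx : expR (eps N * ln N%:R) <= z.
      by apply: mulr_sqrtX_ge => //; [exact: ltnW|near: N].
    have z0 : 0 < z by apply: lt_le_trans zx; exact: expR_gt0.
    (* Inverting [zx] bounds [z^-1] by [expR (- (eps N * ln N%:R))], hence by [v N]. *)
    have zv : z^-1 <= v N.
      rewrite vE; apply: le_trans (expRN_le_inv x0).
      by rewrite expRN lef_pV2 ?posrE ?expR_gt0.
    by rewrite lerD ?ler_wpM2l // -exprVn lerXn2r ?nnegrE ?invr_ge0 // ltW.
  + exact: cvg_cst.
  + have -> : 0 = 8 * 0 + 16 * (0 * 0) :> R by rewrite !mulr0 addr0.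
    by apply: cvgD; apply: cvgM => //; [exact: cvg_cst..|exact: cvgM].
Unshelve. all: by end_near.
Qed.
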